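(* Let $m\ge 3$ and $G=D_{2m}=\langle f,g : f^m=g^2=1,\ gfg^{-1}=f^{-1}\rangle$. Then \[ M_1(\mathcal{C}(G))=\begin{cases}(m-1)(m-2)^2,& m\text{ odd}\\ (m-2)(m-3)^2+m,& m\text{ even,}\end{cases}\] \[ M_2(\mathcal{C}(G))=\begin{cases}\frac{(m-1)(m-2)^3}{2},& m\text{ odd}\\ \frac{(m-2)(m-3)^3}{2}+\frac m2,& m\text{ even,}\end{cases}\] \[ M_1(\mathcal{NC}(G))=\begin{cases}m(m-1)(5m-4),& m\text{ odd}\\ 5m^3-18m^2+16m,& m\text{ even,}\end{cases}\] \[ M_2(\mathcal{NC}(G))=\begin{cases}m(m-1)(4m^2-6m+2),& m\text{ odd}\\ 4m^4-20m^3+32m^2-16m,& m\text{ even.}\end{cases}\] Further, for $\Gamma(G)=\mathcal{C}(G)$ and for $\Gamma(G)=\mathcal{NC}(G)$, \[ \frac{M_2(\Gamma(G))}{|e(\Gamma(G))|}\ge\frac{M_1(\Gamma(G))}{|v(\Gamma(G))|}, \] with equality when $m=4$.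
   Context: For a finite simple undirected graph $\Gamma$ with vertex set $v(\Gamma)$ and edge set $e(\Gamma)$, the first and second Zagreb indices are $M_1(\Gamma)=\sum_{v\in v(\Gamma)}\deg(v)^2$ and $M_2(\Gamma)=\sum_{uv\in e(\Gamma)}\deg(u)\deg(v)$. For a finite non-abelian group $G$ with center $Z(G)$, the commuting graph $\mathcal{C}(G)$ is the simple graph with vertex set $G\setminus Z(G)$ in which two distinct vertices $x,y$ are adjacent iff $xy=yx$; the non-commuting graph $\mathcal{NC}(G)$ is the complement of $\mathcal{C}(G)$ (same vertex set, distinct $x,y$ adjacent iff $xy\ne yx$). *)

(* Defs.v *)
From mathcomp Require Import all_boot all_fingroup all_solvable.

Set Implicit Arguments.
Unset Strict Implicit.
Unset Printing Implicit Defensive.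

Record sgraph := SGraph {
  vertex : finType;
  adj : rel vertex;
  adj_sym : symmetric adj;
  adj_irr : irreflexive adj
}.

Section SimpleGraphs.

Variable Gamma : sgraph.

Definition edges : {set {set vertex Gamma}} :=
  [set [set x; y] | x in {: vertex Gamma}, y in {: vertex Gamma} & adj x y].

Definition deg (x : vertex Gamma) : nat := #|[set y | adj x y]|.

Definition zagreb1 : nat := \sum_(v : vertex Gamma) deg v ^ 2.

(* An edge is an unordered pair {u, v}, so the inner product is
   deg u * deg v. *)
Definition zagreb2 : nat := \sum_(d in edges) \prod_(v in d) deg v.

Definition compl_adj : rel (vertex Gamma) :=
  fun x y => (x != y) && ~~ adj x y.

Fact compl_adj_sym : symmetric compl_adj.
Proof. by move=> x y; rewrite /compl_adj eq_sym adj_sym. Qed.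

Fact compl_adj_irr : irreflexive compl_adj.
Proof. by move=> x; rewrite /compl_adj eqxx. Qed.

Definition complement : sgraph := SGraph compl_adj_sym compl_adj_irr.

End SimpleGraphs.

Section CommutingGraphs.

Local Open Scope group_scope.

Variables (gT : finGroupType) (G : {group gT}).

Definition noncentral : finType := {x : gT | x \in G :\: 'Z(G)}.

Definition comm_adj : rel noncentral :=
  fun x y => (x != y) && (val x * val y == val y * val x).

Fact comm_adj_sym : symmetric comm_adj.
Proof. by move=> x y; rewrite /comm_adj eq_sym [_ * _ == _]eq_sym. Qed.

Fact comm_adj_irr : irreflexive comm_adj.
Proof. by move=> x; rewrite /comm_adj eqxx. Qed.

Definition commuting_graph : sgraph := SGraph comm_adj_sym comm_adj_irr.

Definition noncommuting_graph : sgraph := complement commuting_graph.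

End CommutingGraphs.

(* Main.v *)
(** In either graph the rotations and the reflections form an equitable
    partition of the vertices: the number of neighbours of a vertex in each of
    the two classes depends only on its own class.  These numbers determine the
    Zagreb indices and the number of edges.  In the commuting graph, with
    z = #|Z(G)|, the m - z noncentral rotations form a clique, no rotation is
    adjacent to a reflection, and each reflection r commutes with exactly the
    z - 1 other reflections in Z(G) r.  Once denominators are cleared, the two
    sides of the ratio inequality differ by a product of nonnegative factors,
    which contains (m - 4)^2 when m is even. *)

Require Import Defs.
From HB Require Import structures.
From mathcomp Require Import all_boot all_order all_algebra all_fingroup
  all_solvable.
From mathcomp Require Import ring lra zify.

Set Implicit Arguments.
Unset Strict Implicit.
Unset Printing Implicit Defensive.

Import Order.TTheory GRing.Theory Num.Theory.

Local Open Scope ring_scope.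

(** * Edge sums and equitable partitions of a graph *)

Lemma sum_edges (Gamma : sgraph) (F : {set vertex Gamma} -> nat) :
  (2 * (\sum_(d in edges Gamma) F d)
     = \sum_x \sum_(y | adj x y) F [set x; y])%N.
Proof.
rewrite pair_big_dep /=.
rewrite (partition_big (fun p : vertex Gamma * vertex Gamma => [set p.1; p.2])
  (mem (edges Gamma))) /=; last first.
  by case=> x y /= xy; apply/imset2P; exists x y; rewrite ?inE.
rewrite big_distrr /=; apply: eq_bigr => d /imset2P[x y _].
rewrite inE => /andP[_ xy] ->.
have neq_xy : x != y by apply: contraTneq xy => ->; rewrite adj_irr.
(* The fibre over an edge consists of its two orientations, which are distinct because [adj] is
   irreflexive; this is the source of the factor 2. *)
rewrite (eq_bigl (mem [set (x, y); (y, x)])); last first.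
  case=> u v /=; rewrite !inE; apply/andP/orP.
    case=> uv /eqP eq_uv; have neq_uv : u != v.
      by apply: contraTneq uv => ->; rewrite adj_irr.
    have: u \in [set x; y] by rewrite -eq_uv !inE eqxx.
    have: v \in [set x; y] by rewrite -eq_uv !inE eqxx orbT.
    rewrite !inE !xpair_eqE => /orP[]/eqP ? /orP[]/eqP ?; subst;
      by rewrite ?eqxx ?orbT in neq_uv *; auto.
  by case=> /eqP[-> ->]; rewrite ?[adj y x]adj_sym // setUC.
rewrite big_setU1 ?big_set1 /= ?inE ?xpair_eqE; last first.
  by rewrite negb_and neq_xy.
by rewrite [[set y; x]]setUC mul2n addnn.
Qed.

(** The numbers [aa], [ab], [ba], [bb] are the entries of the quotient matrix of the partition into
    [P] and its complement; the first letter is the class of the vertex, the second that of its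
    neighbours. *)
Definition equitable (Gamma : sgraph) (P : pred (vertex Gamma))
    (nA nB aa ab ba bb : nat) : Prop :=
  [/\ #|[set x | P x]| = nA, #|[set x | ~~ P x]| = nB,
      forall x, P x -> #|[set y | adj x y & P y]| = aa
                       /\ #|[set y | adj x y & ~~ P y]| = ab
    & forall x, ~~ P x -> #|[set y | adj x y & P y]| = ba
                          /\ #|[set y | adj x y & ~~ P y]| = bb].

Lemma sum_split (T : finType) (Q P : pred T) (F : T -> nat) (a b : nat) :
    (forall x, P x -> F x = a) -> (forall x, ~~ P x -> F x = b) ->
  \sum_(x | Q x) F x
    = (#|[set x | Q x & P x]| * a + #|[set x | Q x & ~~ P x]| * b)%N.
Proof.
move=> FA FB; rewrite (bigID P) /= -!sum_nat_const; congr (_ + _)%N.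
  by apply: eq_big => [x | x /andP[_ /FA]]; rewrite ?inE.
by apply: eq_big => [x | x /andP[_ /FB]]; rewrite ?inE.
Qed.

Section Equitable.

Variables (Gamma : sgraph) (P : pred (vertex Gamma)).
Variables (nA nB aa ab ba bb : nat).
Hypothesis equit : equitable P nA nB aa ab ba bb.

Local Notation a := (aa + ab)%N.
Local Notation b := (ba + bb)%N.

Lemma degE x :
  deg x = (#|[set y | adj x y & P y]| + #|[set y | adj x y & ~~ P y]|)%N.
Proof. by rewrite /deg -sum1dep_card (@sum_split _ _ P _ 1 1) ?muln1. Qed.

Lemma deg_in x : P x -> deg x = a.
Proof. by case: equit => _ _ degA _ /degA[aaE abE]; rewrite degE aaE abE. Qed.

Lemma deg_out x : ~~ P x -> deg x = b.
Proof. by case: equit => _ _ _ degB /degB[baE bbE]; rewrite degE baE bbE. Qed.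

Lemma sum_vertices (F : vertex Gamma -> nat) (s t : nat) :
    (forall x, P x -> F x = s) -> (forall x, ~~ P x -> F x = t) ->
  \sum_x F x = (nA * s + nB * t)%N.
Proof.
case: equit => nAE nBE _ _ FA FB; rewrite (sum_split _ FA FB).
rewrite -nAE -nBE.
by congr (#|_| * _ + #|_| * _)%N; apply/setP=> x; rewrite !inE.
Qed.

Lemma card_vertices : #|vertex Gamma| = (nA + nB)%N.
Proof. by rewrite -sum1_card (sum_vertices (s := 1) (t := 1)) ?muln1. Qed.

Lemma zagreb1_equitable : zagreb1 Gamma = (nA * a ^ 2 + nB * b ^ 2)%N.
Proof.
by apply: sum_vertices => x; [move/deg_in-> | move/deg_out->].
Qed.

(** Summing over oriented edges gives, for each vertex, its degree times the sum of the degrees of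
    its neighbours, and both depend only on its class. The factor 2 avoids a division in [nat]. *)
Lemma zagreb2_equitable :
  (2 * zagreb2 Gamma
     = nA * (a * (aa * a + ab * b)) + nB * (b * (ba * a + bb * b)))%N.
Proof.
rewrite /zagreb2 sum_edges.
transitivity (\sum_(x : vertex Gamma) deg x * \sum_(y | adj x y) deg y)%N.
  apply: eq_bigr => x _; rewrite big_distrr /=; apply: eq_bigr => y xy.
  rewrite big_setU1 ?big_set1 // inE.
  by apply: contraTneq xy => ->; rewrite adj_irr.
case: equit => _ _ degA degB.
apply: sum_vertices => x Px; rewrite (sum_split _ deg_in deg_out).
  by rewrite deg_in //; have [-> ->] := degA x Px.
by rewrite deg_out //; have [-> ->] := degB x Px.
Qed.

Lemma card_edges_equitable : (2 * #|edges Gamma| = nA * a + nB * b)%N.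
Proof.
rewrite -sum1_card sum_edges.
transitivity (\sum_(x : vertex Gamma) deg x)%N.
  by apply: eq_bigr => x _; rewrite sum1dep_card.
by apply: sum_vertices => x; [move/deg_in-> | move/deg_out->].
Qed.

(** Within its own class a vertex is a neighbour of itself in neither graph, hence the successors in
    the diagonal entries. The subtractions are exact, since each removes a subset from a set. *)
Lemma equitable_complement :
  @equitable (complement Gamma) P nA nB
    (nA - aa.+1) (nB - ab) (nA - ba) (nB - bb.+1).
Proof.
have compl_in (R : pred (vertex Gamma)) (x : vertex Gamma) : R x ->
    #|[set y | compl_adj x y & R y]|
      = (#|[set y | R y]| - #|[set y | adj x y & R y]|.+1)%N.
  move=> Rx; rewrite -[#|[set y | adj x y & R y]|.+1]add1n.
  have -> : (1 + #|[set y | adj x y & R y]| = #|x |: [set y | adj x y & R y]|)%N.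
    by rewrite cardsU1 !inE adj_irr.
  rewrite -cardsDS; last first.
    by apply/subsetP=> y; rewrite !inE => /orP[/eqP-> //|/andP[]].
  by apply: eq_card => y; rewrite !inE /compl_adj negb_or negb_and eq_sym;
    case: (R y); rewrite ?andbT ?andbF ?orbF.
have compl_out (R : pred (vertex Gamma)) (x : vertex Gamma) : ~~ R x ->
    #|[set y | compl_adj x y & R y]|
      = (#|[set y | R y]| - #|[set y | adj x y & R y]|)%N.
  move=> Rx; rewrite -cardsDS; last by apply/subsetP=> y; rewrite !inE => /andP[].
  apply: eq_card => y; rewrite !inE /compl_adj negb_and eq_sym.
  case: eqVneq => [-> | _] /=; first by rewrite (negbTE Rx) andbF.
  by case: (R y); rewrite ?andbT ?andbF ?orbF.
case: equit => nAE nBE degA degB; split=> // x Px.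
  have [aaE abE] := degA x Px; split.
    by rewrite compl_in // nAE aaE.
  by rewrite (compl_out (predC P)) /= ?negbK // nBE abE.
have [baE bbE] := degB x Px; split.
  by rewrite compl_out // nAE baE.
by rewrite (compl_in (predC P)) // nBE bbE.
Qed.

End Equitable.

(** * Structure of the dihedral group and its commuting relation *)

Section DihedralGroup.

Local Open Scope group_scope.

(** The relations only bound [G] from above, by two cosets of a cyclic group of order at most [m].
    The lower bound [2 * m] comes from mapping [G] onto the concrete dihedral group, so both bounds
    are attained. *)
Lemma dihedral_generators (m : nat) (gT : finGroupType) (G : {group gT}) :
    (3 <= m)%N ->
    G \isog Grp (f : g : f ^+ m = g ^+ 2 = 1, g * f * g^-1 = f^-1) ->
  exists f g : gT, [/\ #[f] = m, g \notin <[f]>, g ^+ 2 = 1, f ^ g = f^-1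
                     & G :=: <[f]> :|: <[f]> :* g].
Proof.
move=> m_ge3 isoG.
have m_gt1 : (1 < m)%N by lia.
have homD : [set: 'D_m.*2] \homg G.
  rewrite isoG.
  have : [set: 'D_m.*2] \homg Grp (x : y : x ^+ m, y ^+ 2, x ^ y = x^-1).
    exact: isoGrp_hom (Grp_dihedral m_gt1).
  case/existsP=> -[x y] /=; rewrite !xpair_eqE => /and4P[genD xm y2 xy].
  apply/existsP; exists (x, y); rewrite /= !xpair_eqE genD xm y2 /=.
  have /eqP yV : y^-1 == y by rewrite eq_invg_mul -expg2.
  by rewrite -(eqP xy) conjgE yV mulgA.
have leG : (m.*2 <= #|G|)%N.
  by have := card_homg homD; rewrite card_dihedral //; apply: dvdn_leq.
case/existsP: (isoGrp_hom isoG) => -[f g] /=.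
rewrite !xpair_eqE => /and4P[/eqP genG /eqP fm /eqP g2 /eqP fgV].
have gV : g^-1 = g by apply/eqP; rewrite eq_invg_mul -expg2 g2.
have fg : f ^ g = f^-1 by rewrite -fgV conjgE gV mulgA.
have defG : G :=: <[f]> * <[g]>.
  rewrite -genG norm_joinEr // cycle_subG inE -cycleJ fg.
  by rewrite cycle_subG groupV cycle_id.
have cyclegE : <[g]> = [set 1; g].
  apply/setP=> x; apply/cycleP/set2P=> [[i ->] | [] ->].
  - by rewrite -(expg_mod i g2) modn2; case: (odd i); [right | left].
  - by exists 0%N.
  - by exists 1%N.
have defG2 : G :=: <[f]> :|: <[f]> :* g.
  by rewrite defG cyclegE mulgU mulg1 -rcosetE.
have of_le : (#[f] <= m)%N by rewrite dvdn_leq ?order_dvdn ?fm //; lia.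
have leG2 : (#|G| <= #[f] + #[f])%N.
  by rewrite defG2 (leq_trans (leq_card_setU _ _)) // card_rcoset.
have ofm : #[f] = m by lia.
(* If [g] were a power of [f], the two cosets would coincide and [G] would have only [m]
   elements. *)
exists f, g; split=> //; apply/negP=> /rcoset_id fgE; move: leG.
by rewrite defG2 fgE setUid -orderE ofm; lia.
Qed.

Lemma card_involutions_cycle (gT : finGroupType) (f : gT) :
  #|[set x in <[f]> | x ^+ 2 == 1]| = (if odd #[f] then 1 else 2)%N.
Proof.
case: ifPn => [odd_f | even_f].
  apply: etrans (cards1 (1 : gT)); apply: eq_card => x; rewrite !inE.
  apply/andP/eqP=> [[fx /eqP x2] | ->]; last by rewrite group1 expg1n.
  apply/eqP; rewrite -order_eq1 -dvdn1 -(eqP (_ : coprime #[f] 2)); last first.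
    by rewrite coprimen2.
  by rewrite dvdn_gcd order_dvdG // order_dvdn x2 eqxx.
have of2 : (#[f] = #[f]./2 + #[f]./2)%N by rewrite addnn even_halfK.
have f_gt0 := order_gt0 f.
have -> : [set x in <[f]> | x ^+ 2 == 1] = [set 1; f ^+ #[f]./2].
  apply/setP=> x; rewrite !inE; apply/andP/orP=> [[fx x2] | [] /eqP ->];
    first 1 last.
  - by rewrite group1 expg1n.
  - by rewrite mem_cycle -expgM muln2 -addnn -of2 expg_order.
  have [i lt_i def_x] := cyclePmin fx; move: x2.
  rewrite def_x -expgM -order_dvdn => /dvdnP[k def_i].
  (* Here [i * 2 = k * #[f]] with [i < #[f]], so [i] is either 0 or half the order. *)
  have : (k < 2)%N by nia.
  case: k def_i => [|[|//]] def_i _; first by left; have ->: i = 0%N by lia.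
  by right; have ->: i = #[f]./2 by lia.
rewrite cards2; suff -> : 1 != f ^+ #[f]./2 by [].
rewrite eq_sym -order_dvdn; apply/negP=> /dvdn_leq; lia.
Qed.

Variables (m : nat) (gT : finGroupType) (G : {group gT}) (f g : gT).
Hypothesis m_ge3 : (3 <= m)%N.
Hypothesis order_f : #[f] = m.
Hypothesis g_notin : g \notin <[f]>.
Hypothesis g_invol : g ^+ 2 = 1.
Hypothesis fJg : f ^ g = f^-1.
Hypothesis defG : G :=: <[f]> :|: <[f]> :* g.

(** [K] turns out to be the center of [G], and [z] its order. *)
Local Notation K := [set x in <[f]> | x ^+ 2 == 1].
Local Notation z := (if odd m then 1 else 2)%N.

Let gV : g^-1 = g.
Proof. by apply/eqP; rewrite eq_invg_mul -expg2 g_invol. Qed.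

Let cycleJ_inv r : r \in <[f]> -> r ^ g = r^-1.
Proof. by case/cycleP=> i ->; rewrite conjXg fJg expgVn. Qed.

Let cycle_comm r s : r \in <[f]> -> s \in <[f]> -> commute r s.
Proof. by move=> fr fs; apply: (centsP (cycle_abelian f)). Qed.

Let refl_in_G r : r \in <[f]> -> r * g \in G.
Proof. by move=> fr; rewrite defG inE mem_rcoset mulgK fr orbT. Qed.

Let refl_notin r : r \in <[f]> -> r * g \notin <[f]>.
Proof. by move=> fr; rewrite groupMl. Qed.

Let reflP y : y \in G -> y \notin <[f]> -> exists2 r, r \in <[f]> & y = r * g.
Proof. by rewrite defG inE => /orP[-> // | /rcosetP]. Qed.

(** Since [g] inverts rotations, the two products are [r * s^-1] and [s * r^-1], which are inverse
    to each other. *)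
Lemma commute_reflections r s : r \in <[f]> -> s \in <[f]> ->
  (r * g * (s * g) == s * g * (r * g)) = ((s * r^-1) ^+ 2 == 1).
Proof.
move=> fr fs.
have mulE u v : v \in <[f]> -> u * g * (v * g) = u * v^-1.
  by move=> fv; rewrite -(cycleJ_inv fv) conjgE gV !mulgA.
rewrite !mulE // expg2 -eq_invg_mul invMg invgK.
by congr (_ == _).
Qed.

Lemma commute_rotation_reflection r s : r \in <[f]> -> s \in <[f]> ->
  (r * (s * g) == s * g * r) = (r ^+ 2 == 1).
Proof.
move=> fr fs; have -> : s * g * r = s * r^-1 * g.
  rewrite -(cycleJ_inv fr) conjgE gV !mulgA.
  by rewrite -[X in _ = X]mulgA -expg2 g_invol mulg1.
rewrite mulgA (inj_eq (mulIg g)) (cycle_comm fr fs) (inj_eq (mulgI s)).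
by rewrite eq_sym eq_invg_mul -expg2.
Qed.

Lemma f_sq_neq1 : f ^+ 2 != 1.
Proof. by rewrite -order_dvdn order_f; apply/negP=> /dvdn_leq; lia. Qed.

(** A central reflection would commute with [f] and force [f ^+ 2 = 1], against [3 <= m]; a rotation
    is tested against [g]. *)
Lemma dihedral_center : 'Z(G) = K.
Proof.
have fG : f \in G by rewrite defG inE cycle_id.
have gG : g \in G by rewrite -[g]mul1g refl_in_G.
apply/setP=> x; rewrite !inE; apply/andP/andP=> [[xG cx] | [fx x2]].
  have fx : x \in <[f]>.
    apply: contraT => /(reflP xG)[s fs def_x]; case/negP: f_sq_neq1.
    rewrite -(commute_rotation_reflection (cycle_id f) fs) -def_x.
    by rewrite (centP cx f fG).
  split=> //; rewrite -(commute_rotation_reflection fx (group1 _)) mul1g.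
  by rewrite (centP cx g gG).
split; first by rewrite defG inE fx.
apply/centP=> y yG; have [fy | /(reflP yG)[s fs ->]] := boolP (y \in <[f]>).
  exact: cycle_comm.
by apply/eqP; rewrite commute_rotation_reflection.
Qed.

Lemma noncentral_dihedral : G :\: 'Z(G) = (<[f]> :\: K) :|: <[f]> :* g.
Proof.
rewrite dihedral_center defG setDUl; congr (_ :|: _).
apply/setDidPl; rewrite disjoint_sym; apply/pred0P=> x /=; rewrite !inE.
apply/negP=> /andP[/andP[fx _]] /rcosetP[s fs def_x].
by move: (refl_notin fs); rewrite -def_x fx.
Qed.

(** Moves neighbour counts from the subtype of vertices to subsets of the ambient group, where
    cosets are available. *)
Lemma card_noncentral (Q : pred gT) :
  #|[set x : noncentral G | Q (val x)]| = #|[set x in G :\: 'Z(G) | Q x]|.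
Proof.
rewrite -(card_imset _ val_inj); apply: eq_card => x; rewrite [RHS]inE.
apply/imsetP/andP=> [[v Qv ->] | [Gx Qx]].
  by rewrite inE in Qv; rewrite (valP v).
by exists (Sub x Gx); rewrite ?inE SubK.
Qed.

Lemma equitable_commuting_dihedral :
  @equitable (commuting_graph G) (fun x => val x \in <[f]>)
    (m - z) m (m - z).-1 0 0 z.-1.
Proof.
have cardK : #|K| = z by rewrite card_involutions_cycle order_f.
have cardFK : #|<[f]> :\: K| = (m - z)%N.
  rewrite cardsDS -?orderE ?order_f ?cardK //.
  by apply/subsetP=> x; rewrite inE => /andP[].
have inD x : (x \in G :\: 'Z(G))
    = (x \in <[f]>) && (x ^+ 2 != 1) || (x \in <[f]> :* g).
  rewrite noncentral_dihedral !inE negb_and.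
  by case: (x \in <[f]>); rewrite ?andbT ?andbF.
have refl_out x : x \in <[f]> :* g -> x \notin <[f]>.
  by case/rcosetP=> r fr ->; apply: refl_notin.
have rotE x : (x \in G :\: 'Z(G)) && (x \in <[f]>) = (x \in <[f]> :\: K).
  rewrite inD !inE negb_and andbC; have [fx | ] := boolP (x \in <[f]>) => //=.
  by rewrite andbT; have [/refl_out/negP[] | _] := boolP (x \in <[f]> :* g);
    rewrite ?orbF.
have reflE x : (x \in G :\: 'Z(G)) && (x \notin <[f]>) = (x \in <[f]> :* g).
  rewrite inD; have [/refl_out-> | _] := boolP (x \in _ :* g).
    by rewrite orbT.
  by rewrite orbF; case: (x \in <[f]>); rewrite ?andbF.
have rot_in x : x \in G :\: 'Z(G) -> x \in <[f]> -> x ^+ 2 != 1.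
  by rewrite inD => + fx; case/orP=> [/andP[] | /refl_out]; rewrite ?fx.
have refl_in x : x \in G :\: 'Z(G) -> x \notin <[f]> ->
    exists2 r, r \in <[f]> & x = r * g.
  by rewrite inE => /andP[_ xG]; apply: reflP.
have adjE (x y : noncentral G) :
    comm_adj x y = (val y != val x) && (val x * val y == val y * val x).
  by rewrite /comm_adj eq_sym.
split=> [||x fx|x fx].
- rewrite (card_noncentral (fun x => x \in <[f]>)) -cardFK.
  by apply: eq_card => x; rewrite inE rotE.
- rewrite (card_noncentral (fun x => x \notin <[f]>)) -order_f orderE.
  by rewrite -(card_rcoset <[f]> g); apply: eq_card => x; rewrite inE reflE.
- split.
    rewrite (eq_card (_ : _ =i [set y : noncentral G |
      (val y != val x) && (val y \in <[f]>)])); last first.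
      move=> y; rewrite !inE /= adjE.
      case: (boolP (val y \in _)) => [fy|]; rewrite ?andbF //.
      by rewrite (cycle_comm fx fy) eqxx !andbT.
    rewrite (card_noncentral (fun y => (y != val x) && (y \in <[f]>))).
    rewrite -cardFK (cardsD1 (val x) (_ :\: K)).
    rewrite !inE fx (rot_in _ (valP x) fx) /=.
    by apply: eq_card => y; rewrite inE andbCA rotE [in RHS]inE in_set1.
  (* A rotation commuting with a reflection squares to 1, hence is central and not a vertex. *)
  apply: eq_card0 => y; rewrite !inE /= adjE.
  have [//|fy] := boolP (val y \in <[f]>); rewrite ?andbF //.
  have [s fs ->] := refl_in _ (valP y) fy.
  rewrite commute_rotation_reflection //.
  by rewrite (negbTE (rot_in _ (valP x) fx)) andbF.
have [s fs def_x] := refl_in _ (valP x) fx.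
split.
  apply: eq_card0 => y; rewrite !inE /= adjE def_x.
  have [fy|] := boolP (val y \in <[f]>); rewrite ?andbF //.
  by rewrite andbT [X in _ && X]eq_sym commute_rotation_reflection //
    (negbTE (rot_in _ (valP y) fy)) andbF.
rewrite (eq_card (_ : _ =i [set y : noncentral G | [&& val y != val x,
    val x * val y == val y * val x & val y \notin <[f]>]])); last first.
  by move=> y; rewrite !inE /= adjE andbA.
rewrite (card_noncentral (fun y => [&& y != val x,
  val x * y == y * val x & y \notin <[f]>])).
(* The reflections commuting with [x] form the coset [K :* val x]; removing [x] itself leaves [z.-1]
   neighbours. *)
rewrite -cardK -(card_rcoset K (val x)) (cardsD1 (val x) (K :* val x)).
rewrite mem_rcoset mulgV !inE group1 expg1n eqxx /=.
apply: eq_card => y; rewrite inE andbCA [in RHS]inE in_set1; congr (_ && _).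
rewrite andbCA reflE [in RHS]mem_rcoset [in RHS]inE def_x andbC.
have [/rcosetP[r fr ->] | ] := boolP (y \in <[f]> :* g).
  rewrite commute_reflections // invMg mulgA mulgK.
  by rewrite groupM ?groupV.
by rewrite mem_rcoset /= invMg gV mulgA (groupMr _ (groupVr fs)) => /negbTE->.
Qed.

End DihedralGroup.

(** * Comparison of the ratios and evaluation for both parities *)

(** The gap [d] between the cross products is a natural number, so exhibiting it as a polynomial in
    naturals already proves the inequality. The doubled quantities are those that an equitable
    partition computes. *)
Lemma zagreb_ratio_le (Gamma : sgraph) (d : nat) :
    (0 < 2 * #|edges Gamma|)%N -> (0 < #|vertex Gamma|)%N ->
    (zagreb1 Gamma * (2 * #|edges Gamma|) + d
       = 2 * zagreb2 Gamma * #|vertex Gamma|)%N ->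
  (zagreb1 Gamma)%:R / #|vertex Gamma|%:R
    <= (zagreb2 Gamma)%:R / #|edges Gamma|%:R :> rat
  /\ (d = 0%N -> (zagreb2 Gamma)%:R / #|edges Gamma|%:R
                 = (zagreb1 Gamma)%:R / #|vertex Gamma|%:R :> rat).
Proof.
rewrite muln_gt0 /= => e_gt0 v_gt0 eq_d; split=> [|d0].
  rewrite ler_pdivrMr ?ltr0n // mulrAC ler_pdivlMr ?ltr0n // -!natrM ler_nat.
  by nia.
apply/eqP; rewrite eqr_div ?pnatr_eq0 -?lt0n // -!natrM eqr_nat.
by apply/eqP; nia.
Qed.

Lemma natr_half (M X : nat) : (2 * M = X)%N -> M%:R = X%:R / 2 :> rat.
Proof. by move=> <-; rewrite natrM mulrC mulKf. Qed.

Theorem theorem2p3 (m : nat) (gT : finGroupType) (G : {group gT}) :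
  (3 <= m)%N ->
  (G \isog Grp (f : g : f ^+ m = g ^+ 2 = 1, g * f * g^-1 = f^-1))%g ->
  [/\ (zagreb1 (commuting_graph G))%:R =
        (if odd m then (m%:R - 1) * (m%:R - 2) ^+ 2
         else (m%:R - 2) * (m%:R - 3) ^+ 2 + m%:R) :> rat,
      (zagreb2 (commuting_graph G))%:R =
        (if odd m then (m%:R - 1) * (m%:R - 2) ^+ 3 / 2
         else (m%:R - 2) * (m%:R - 3) ^+ 3 / 2 + m%:R / 2) :> rat,
      (zagreb1 (noncommuting_graph G))%:R =
        (if odd m then m%:R * (m%:R - 1) * (5 * m%:R - 4)
         else 5 * m%:R ^+ 3 - 18 * m%:R ^+ 2 + 16 * m%:R) :> rat
    & (zagreb2 (noncommuting_graph G))%:R =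
        (if odd m then m%:R * (m%:R - 1) * (4 * m%:R ^+ 2 - 6 * m%:R + 2)
         else 4 * m%:R ^+ 4 - 20 * m%:R ^+ 3 + 32 * m%:R ^+ 2
              - 16 * m%:R) :> rat]
  /\ forall Gamma : sgraph,
       Gamma = commuting_graph G \/ Gamma = noncommuting_graph G ->
       (zagreb2 Gamma)%:R / #|edges Gamma|%:R
         >= (zagreb1 Gamma)%:R / #|vertex Gamma|%:R :> rat
       /\ (m = 4%N ->
           (zagreb2 Gamma)%:R / #|edges Gamma|%:R
             = (zagreb1 Gamma)%:R / #|vertex Gamma|%:R :> rat).
Proof.
move=> m_ge3 /(dihedral_generators m_ge3)[f [g [of_m g_notin g2 fJg defG]]].
have := equitable_commuting_dihedral m_ge3 of_m g_notin g2 fJg defG.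
have [odd_m | even_m] := boolP (odd m).
  (* Shifting by the least odd value of [m] turns every truncated subtraction into a polynomial in
     [k]. *)
  have [k def_m] : exists k, m = (k + 3)%N by exists (m - 3)%N; lia.
  rewrite /= (_ : m - 1 = k + 2)%N; last by rewrite def_m; lia.
  rewrite (_ : (k + 2).-1 = k + 1)%N; last by rewrite addnS.
  rewrite def_m => C; have := equitable_complement C.
  (* The rotations form a clique in the commuting graph, so they are independent in its
     complement. *)
  rewrite (_ : k + 2 - (k + 1).+1 = 0)%N; last by lia.
  rewrite (_ : k + 3 - 1 = k + 2)%N; last by lia.
  rewrite !subn0.
  move=> NC; split.
    split.
    - by rewrite (zagreb1_equitable C); ring.
    - by rewrite (natr_half (zagreb2_equitable C)); field.
    - by rewrite (zagreb1_equitable NC); ring.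
    - by rewrite (natr_half (zagreb2_equitable NC)); field.
  move=> Gamma [] ->.
    (* With class sizes [nA], [nB] and degrees [a], [b], no edge joins the two classes, and the gap
       is [nA * nB * (a - b) ^ 2 * (a + b)]; here [a = k + 1] and [b = 0]. *)
    have [||| le_ratio _] := @zagreb_ratio_le (commuting_graph G)
        ((k + 2) * (k + 1) ^ 3 * (k + 3)).
    - by rewrite (card_edges_equitable C); lia.
    - by rewrite (card_vertices C); lia.
    - rewrite (zagreb1_equitable C) (zagreb2_equitable C).
      by rewrite (card_edges_equitable C) (card_vertices C); ring.
    by split=> // m4; rewrite def_m m4 in odd_m.
  (* Here [a = k + 3] and [b = 2 * (k + 2)], and the gap is [nA * nB * (a - b) ^ 2 * (k + 2)]. *)
  have [||| le_ratio _] := @zagreb_ratio_le (noncommuting_graph G)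
      ((k + 3) * (k + 2) ^ 2 * (k + 1) ^ 2).
  - by rewrite (card_edges_equitable NC); lia.
  - by rewrite (card_vertices NC); lia.
  - rewrite (zagreb1_equitable NC) (zagreb2_equitable NC).
    by rewrite (card_edges_equitable NC) (card_vertices NC); ring.
  by split=> // m4; rewrite def_m m4 in odd_m.
have [k def_m] : exists k, m = (k + 4)%N by exists (m - 4)%N; lia.
rewrite /= (_ : m - 2 = k + 2)%N; last by rewrite def_m; lia.
rewrite (_ : (k + 2).-1 = k + 1)%N; last by rewrite addnS.
rewrite def_m => C; have := equitable_complement C.
rewrite (_ : k + 2 - (k + 1).+1 = 0)%N; last by lia.
rewrite (_ : k + 4 - 2 = k + 2)%N; last by lia.
rewrite !subn0.
move=> NC; split.
  split.
  - by rewrite (zagreb1_equitable C); ring.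
  - by rewrite (natr_half (zagreb2_equitable C)); field.
  - by rewrite (zagreb1_equitable NC); ring.
  - by rewrite (natr_half (zagreb2_equitable NC)); field.
move=> Gamma [] ->.
  (* The same product with [a = k + 1] and [b = 1]. The factor [k ^ 2] is [(a - b) ^ 2]: at [m = 4]
     the graph is regular, which gives equality. *)
  have [||| le_ratio eq_ratio] := @zagreb_ratio_le (commuting_graph G)
      ((k + 2) * (k + 4) * k ^ 2 * (k + 2)).
  - by rewrite (card_edges_equitable C); lia.
  - by rewrite (card_vertices C); lia.
  - rewrite (zagreb1_equitable C) (zagreb2_equitable C).
    by rewrite (card_edges_equitable C) (card_vertices C); ring.
  by split=> // m4; apply: eq_ratio; have -> : k = 0%N by lia.
(* Now [a = k + 4] and [b = 2 * (k + 2)] differ by [k], so this graph too is regular at [m = 4]. *)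
have [||| le_ratio eq_ratio] := @zagreb_ratio_le (noncommuting_graph G)
    ((k + 4) * (k + 2) ^ 2 * k ^ 2).
- by rewrite (card_edges_equitable NC); lia.
- by rewrite (card_vertices NC); lia.
- rewrite (zagreb1_equitable NC) (zagreb2_equitable NC).
  by rewrite (card_edges_equitable NC) (card_vertices NC); ring.
by split=> // m4; apply: eq_ratio; have -> : k = 0%N by lia.
Qed.
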